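(* Let $\lambda\in\mathbb{R}$, let $Y$ be a random variable whose moment generating function exists in a neighborhood of the origin, and let $x\in[0,1]$ with $(x)_{k,\lambda}\neq0$. For all integers $n\ge k\ge 0$, \[ E\big[(Y)_{n-k,\lambda}\big]=\sum_{l=0}^{n-k}\sum_{j=0}^{l}\frac{\binom{x}{j}}{\binom{x}{k}_{\lambda}}\frac{j!}{k!}{l \brace j}_{Y,\lambda}\frac{\binom{n}{l}}{\binom{n}{k}}B_{k,n-l}^{Y}(x|\lambda). \]
   Context: For $\lambda\in\mathbb{R}$, $(x)_{0,\lambda}=1$, $(x)_{n,\lambda}=x(x-\lambda)\cdots(x-(n-1)\lambda)$ for $n\ge1$, and the degenerate binomial coefficient is $\binom{x}{k}_\lambda=\frac{(x)_{k,\lambda}}{k!}$; $\binom{x}{j}=x(x-1)\cdots(x-j+1)/j!$. Let $e_\lambda^x(t)=\sum_{n\ge0}(x)_{n,\lambda}\frac{t^n}{n!}$. For the random variable $Y$, $E[e_\lambda^Y(t)]$ denotes the power series $\sum_{n\ge0}E[(Y)_{n,\lambda}]\frac{t^n}{n!}$ (constant term $1$); for real $a$, $(E[e_\lambda^Y(t)])^a=\sum_{j\ge0}\binom{a}{j}(E[e_\lambda^Y(t)]-1)^j$. The probabilistic degenerate Stirling numbers of the second kind: $\frac{1}{k!}(E[e_\lambda^Y(t)]-1)^k=\sum_{n\ge k}{n\brace k}_{Y,\lambda}\frac{t^n}{n!}$. The probabilistic degenerate Bernstein polynomials: $\frac{1}{k!}(x)_{k,\lambda}t^k(E[e_\lambda^Y(t)])^{1-x}=\sum_{n\ge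 k}B_{k,n}^{Y}(x|\lambda)\frac{t^n}{n!}$. *)

(* Defs.v *)
From HB Require Import structures.
From mathcomp Require Import all_boot all_order all_algebra.
From mathcomp Require Import all_classical all_reals all_analysis.

Set Implicit Arguments.
Unset Strict Implicit.
Unset Printing Implicit Defensive.

Import Order.TTheory GRing.Theory Num.Theory.
Import numFieldNormedType.Exports.

Local Open Scope classical_set_scope.
Local Open Scope ring_scope.

Section Factorials.
Context {R : realType}.
Implicit Types (lam x : R).

(* (x)_{n,lam} = x (x - lam) ... (x - (n-1) lam) *)
Definition dfact lam x n : R := \prod_(i < n) (x - i%:R * lam).

Definition dbinom lam x k : R := dfact lam x k / k`!%:R.

Definition gbinom x j : R := \prod_(i < j) (x - i%:R) / j`!%:R.

End Factorials.

(* A formal power series sum_n a_n t^n is represented by its sequence of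
   coefficients n |-> a_n.  The product is the Cauchy product, not the pointwise
   product that the library puts on functions. *)
Section FormalPowerSeries.
Context {R : realType}.

Definition fps : Type := nat -> R.

Implicit Types (f g : fps) (a c : R).

Definition fps_const c : fps := fun n => if n == 0%N then c else 0.

Definition fps_monom k : fps := fun n => (n == k)%:R.

Definition fps_sub f g : fps := fun n => f n - g n.

Definition fps_scale c f : fps := fun n => c * f n.

Definition fps_mul f g : fps := fun n => \sum_(i < n.+1) f i * g (n - i)%N.

Definition fps_exp f j : fps := iter j (fps_mul f) (fps_const 1).

(* f^a = sum_(j >= 0) binom(a, j) (f - 1)^j, the infinite sum being taken
   coefficientwise.  When f has constant term 1, the coefficient of t^n of
   (f - 1)^j vanishes for j > n, so that each of these sums is finite. *)
Definition fps_rpow f a : fps := fun n =>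
  limn (series (fun j => gbinom a j * fps_exp (fps_sub f (fps_const 1)) j n)).

(* The coefficient of t^n / n! *)
Definition egf_coef f n : R := n`!%:R * f n.

End FormalPowerSeries.
Arguments fps R : clear implicits.

Lemma fps_exp_small (R : realType) (f : fps R) j n :
  f 0%N = 0 -> (n < j)%N -> fps_exp f j n = 0.
Proof.
move=> f0; elim: j n => [//|j IH] n nj; rewrite /fps_exp iterS.
apply: big1 => -[[|i] /= lti] _; first by rewrite f0 mul0r.
rewrite -/(fps_exp f j) IH ?mulr0//.
by rewrite ltn_subLR// addSn ltnS (leq_trans (_ : n <= j)%N)// leq_addl.
Qed.

Lemma fps_rpowE (R : realType) (f : fps R) a n : f 0%N = 1 ->
  fps_rpow f a n =
  \sum_(j < n.+1) gbinom a j * fps_exp (fps_sub f (fps_const 1)) j n.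
Proof.
move=> f0; apply: cvg_lim => //; apply: cvg_near_cst.
near=> m; rewrite /series/= -[RHS](big_mkord xpredT (fun j => gbinom a j * _ j n)).
rewrite (@big_cat_nat _ _ _ n.+1)//=; last by near: m; exists n.+1.
rewrite [X in _ + X]big_nat_cond [X in _ + X]big1 ?addr0// => j /andP[/andP[nj _] _].
by rewrite fps_exp_small ?mulr0// /fps_sub f0 subrr.
Unshelve. all: by end_near. Qed.

Section Probabilistic.
Context {d : measure_display} {T : measurableType d} {R : realType}.
Variable P : probability T R.
Implicit Types (Y : {RV P >-> R}) (lam x : R).

(* The real number E[(Y)_{n,lam}]; [fine] is only meaningful when this moment
   is finite, which holds when Y has a moment generating function near 0. *)
Definition dmoment Y lam n : R := fine 'E_P[fun w => dfact lam (Y w) n].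

(* E[e_lam^Y(t)] *)
Definition dmgf Y lam : fps R := fun n => dmoment Y lam n / n`!%:R.

Definition pdstirling2 Y lam (n k : nat) : R :=
  egf_coef (fps_scale (k`!%:R)^-1
              (fps_exp (fps_sub (dmgf Y lam) (fps_const 1)) k)) n.

Definition pdbernstein Y lam (k n : nat) x : R :=
  egf_coef (fps_scale ((k`!%:R)^-1 * dfact lam x k)
              (fps_mul (fps_monom k) (fps_rpow (dmgf Y lam) (1 - x)))) n.

Lemma dmgf0 Y lam : dmgf Y lam 0 = 1.
Proof.
rewrite /dmgf /dmoment fact0 divr1.
rewrite (_ : (fun w => _) = cst 1) ?expectation_cst//.
by apply/funext => w; rewrite /dfact big_ord0.
Qed.

Lemma pdstirling2_small Y lam n k : (n < k)%N -> pdstirling2 Y lam n k = 0.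
Proof.
move=> nk; rewrite /pdstirling2 /egf_coef /fps_scale fps_exp_small ?mulr0//.
by rewrite /fps_sub dmgf0 subrr.
Qed.

Lemma pdbernstein_small Y lam k n x : (n < k)%N -> pdbernstein Y lam k n x = 0.
Proof.
move=> nk; rewrite /pdbernstein /egf_coef /fps_scale /fps_mul big1 ?mulr0// => i _.
by rewrite /fps_monom ltn_eqF ?mul0r// (leq_trans _ nk)// ltn_ord.
Qed.

End Probabilistic.

(* Main.v *)
Require Import Defs.
From HB Require Import structures.
From mathcomp Require Import all_boot all_order all_algebra.
From mathcomp Require Import all_classical all_reals all_analysis.
From mathcomp Require Import measurable_realfun.
From mathcomp Require Import ring lra.
Import Order.TTheory GRing.Theory Num.Theory.
Import numFieldNormedType.Exports.
Local Open Scope classical_set_scope.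
Local Open Scope ring_scope.

Set Implicit Arguments.
Unset Strict Implicit.
Unset Printing Implicit Defensive.

(** Since [E[e_lam^Y(t)]] is the product of its [x]-th and [(1-x)]-th powers, the
    theorem is the comparison of coefficients in this identity: up to factorials,
    the Stirling numbers give the coefficients of the first power and the
    Bernstein polynomials those of the second. The powers multiply by the
    Chu-Vandermonde identity, applied to truncated polynomials. The
    moments are finite because [|(Y)_{n,lam}|] is dominated by a multiple of
    [exp(tY) + exp(-tY)]. *)

Section GeneralizedBinomial.
Context {R : realType}.
Implicit Types a b : R.

(** The absorption rule, which drives the induction for Chu-Vandermonde. *)
Lemma gbinomS a i : i.+1%:R * gbinom a i.+1 = (a - i%:R) * gbinom a i.
Proof.
rewrite /gbinom big_ord_recr /= factS natrM.
have fi : i`!%:R != 0 :> R by rewrite pnatr_eq0 -lt0n fact_gt0.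
have i1 : i.+1%:R != 0 :> R by rewrite pnatr_eq0.
by field; apply/andP; split => //; rewrite -natr1 in i1; rewrite addrC.
Qed.

Lemma gbinom0 a : gbinom a 0 = 1.
Proof. by rewrite /gbinom big_ord0 fact0 divr1. Qed.

Lemma gbinom1 j : gbinom (1 : R) j = (j <= 1)%:R.
Proof.
case: j => [|[|j]]; first exact: gbinom0.
  by rewrite /gbinom big_ord1 subr0 divr1.
by rewrite /gbinom !big_ord_recl/= /bump/= subrr mul0r mulr0 mul0r.
Qed.

Lemma gbinom_Vandermonde a b m :
  \sum_(i < m.+1) gbinom a i * gbinom b (m - i)%N = gbinom (a + b) m.
Proof.
elim: m => [|m IH]; first by rewrite big_ord1 !gbinom0 mulr1.
have m0 : m.+1%:R != 0 :> R by rewrite pnatr_eq0.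
apply: (mulfI m0); rewrite gbinomS -IH !mulr_sumr.
transitivity (\sum_(i < m.+2) (i%:R * gbinom a i * gbinom b (m.+1 - i)%N +
    gbinom a i * ((m.+1 - i)%:R * gbinom b (m.+1 - i)%N))).
  apply: eq_bigr => i _.
  (* Each half of this splitting is absorbed by one of the two binomials; after reindexing, the
     factors [a - i] and [b - (m - i)] add up to [a + b - m]. *)
  have -> : m.+1%:R = i%:R + (m.+1 - i)%:R :> R by rewrite -natrD subnKC// -ltnS.
  by rewrite mulrDl; congr (_ + _); [exact: mulrA | exact: mulrCA].
rewrite big_split/= big_ord_recl/= !mul0r add0r.
rewrite [X in _ + X]big_ord_recr/= subnn mul0r mulr0 addr0 -big_split/=.
apply: eq_bigr => i _; have im : (i <= m)%N by rewrite -ltnS.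
rewrite /bump/= add1n subSS subSn// !gbinomS natrB//.
by move: (gbinom a i) (gbinom b (m - i)%N) => u v; ring.
Qed.

End GeneralizedBinomial.

Section RealPowers.
Context {R : realType}.
Implicit Types (f g : fps R) (a b : R) (p q : {poly R}).

(** Coefficients up to [n] of a product see only those of the factors, so truncation to polynomials
    gives access to ring identities. *)
Lemma fps_mul_coef f g p q n :
  (forall i, (i <= n)%N -> f i = p`_i) -> (forall i, (i <= n)%N -> g i = q`_i) ->
  fps_mul f g n = (p * q)`_n.
Proof.
move=> fp gq; rewrite coefM; apply: eq_bigr => i _.
have iN : (i <= n)%N by rewrite -ltnS.
by rewrite fp// gq// leq_subr.
Qed.

Lemma fps_exp_coef f p n j : (forall i, (i <= n)%N -> f i = p`_i) ->
  forall i, (i <= n)%N -> fps_exp f j i = (p ^+ j)`_i.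
Proof.
move=> fp; elim: j => [|j IH] i ni.
  by rewrite expr0 coef1 /fps_exp/= /fps_const; case: eqP.
rewrite exprS; apply: fps_mul_coef => m mi; [apply: fp|apply: IH];
  exact: leq_trans mi ni.
Qed.

Lemma coef_comp_poly_trunc p q n : (forall j, (n < j)%N -> (q ^+ j)`_n = 0) ->
  (p \Po q)`_n = \sum_(j < n.+1) p`_j * (q ^+ j)`_n.
Proof.
move=> q0; rewrite coef_comp_poly.
(* Beyond [size p] the coefficient of [p] vanishes, beyond [n] that of [q ^+ j]; the longer sum thus
   reduces to the shorter. *)
have H (N M : nat) : (forall j, (N <= j)%N -> p`_j * (q ^+ j)`_n = 0) ->
    (N <= M)%N ->
    \sum_(j < M) p`_j * (q ^+ j)`_n = \sum_(j < N) p`_j * (q ^+ j)`_n.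
  move=> z NM; rewrite -!(big_mkord xpredT (fun j => p`_j * (q ^+ j)`_n)).
  rewrite (@big_cat_nat _ _ _ N)//= [X in _ + X]big_nat_cond.
  by rewrite [X in _ + X]big1 ?addr0// => j /andP[/andP[nj _] _]; apply: z.
have [sn|ns] := leqP (size p) n.+1.
  by rewrite (H (size p) n.+1)// => j sj; rewrite nth_default// mul0r.
by rewrite (H n.+1 (size p))// => [j nj|]; [rewrite q0 ?mulr0|apply: ltnW].
Qed.

(** Up to degree [n], the power [f^c] is a truncated binomial series [B c] composed with the
    truncation [q] of [f - 1]. Composition with [q] is multiplicative, and the coefficients of
    [B a * B b] up to [n] are Vandermonde sums; the higher ones do not matter, since [q] has no
    constant term. *)
Lemma fps_rpow_mul f a b n : f 0%N = 1 ->
  fps_mul (fps_rpow f a) (fps_rpow f b) n = fps_rpow f (a + b) n.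
Proof.
move=> f0; set g := fps_sub f (fps_const 1).
have g0 : g 0%N = 0 by rewrite /g /fps_sub f0 subrr.
pose q := \poly_(i < n.+1) g i.
pose B (c : R) := \poly_(i < n.+1) gbinom c i.
have gq i : (i <= n)%N -> g i = q`_i by move=> ni; rewrite coef_poly ltnS ni.
have q0 i j : (i <= n)%N -> (i < j)%N -> (q ^+ j)`_i = 0.
  by move=> ni ij; rewrite -(fps_exp_coef _ gq)// fps_exp_small.
have rpowq c i : (i <= n)%N -> fps_rpow f c i = (B c \Po q)`_i.
  move=> ni; rewrite fps_rpowE// coef_comp_poly_trunc; last by move=> j; exact: q0.
  apply: eq_bigr => j _; rewrite (fps_exp_coef _ gq)// coef_poly.
  by rewrite (leq_trans (ltn_ord j)).
rewrite (fps_mul_coef (rpowq a) (rpowq b)) -comp_polyM fps_rpowE//.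
rewrite coef_comp_poly_trunc; last by move=> j; exact: q0.
apply: eq_bigr => j _; rewrite (fps_exp_coef _ gq)//; congr (_ * _).
rewrite coefM -gbinom_Vandermonde; apply: eq_bigr => i _.
have jn : (j < n.+1)%N := ltn_ord j.
rewrite !coef_poly (leq_trans (ltn_ord i))// (leq_ltn_trans _ jn)//.
exact: leq_subr.
Qed.

(** The binomial series for exponent 1 stops after [1 + (f - 1)]. *)
Lemma fps_rpow1 f n : f 0%N = 1 -> fps_rpow f 1 n = f n.
Proof.
move=> f0; rewrite fps_rpowE//; case: n => [|n].
  by rewrite big_ord1 gbinom0 mul1r f0.
rewrite !big_ord_recl big1 => [|i _]; last by rewrite gbinom1 mul0r.
rewrite /= !gbinom1 /= addr0 mulr0 add0r mul1r /fps_mul.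
rewrite big_ord_recr/= subnn /fps_const/= mulr1 big1 => [|i _].
  by rewrite add0r /fps_sub/= subr0.
by rewrite subn_eq0 leqNgt ltn_ord mulr0.
Qed.

End RealPowers.

(** Each new factor costs one [expR (s * |y|)], because [1 + s * |y| <= expR (s * |y|)]. The rate
    [s] is left free so that [s *+ n] can be kept inside the domain of the moment generating
    function. *)
Lemma dfact_expR_bound (R : realType) (lam s : R) n : 0 < s ->
  exists2 C, 0 <= C & forall y, `|dfact lam y n| <= C * expR (s *+ n * `|y|).
Proof.
move=> s0; elim: n => [|n [C C0 IH]].
  by exists 1 => // y; rewrite /dfact big_ord0 normr1 mulr0n mul0r expR0 mulr1.
exists (C * (s^-1 + `|n%:R * lam|)) => [|y].
  by rewrite mulr_ge0// addr_ge0// invr_ge0 ltW.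
rewrite /dfact big_ord_recr/= normrM mulrSr mulrDl expRD.
rewrite [leRHS](_ : _ = C * expR (s *+ n * `|y|) *
  ((s^-1 + `|n%:R * lam|) * expR (s * `|y|))); last by ring.
apply: ler_pM => //; first exact: IH.
have e1 : 1 + s * `|y| <= expR (s * `|y|) by exact: expR_ge1Dx.
apply: (le_trans (ler_normB _ _)); rewrite mulrDl lerD//.
  rewrite ler_pdivlMl//; apply: le_trans e1; lra.
by apply: ler_peMr => //; apply: le_trans e1; rewrite lerDl mulr_ge0// ltW.
Qed.

Lemma expectation_dfact_fin_num d (T : measurableType d) (R : realType)
    (P : probability T R) (Y : {RV P >-> R}) (lam : R) n :
  (\forall t \near (0 : R), ('M_P Y t < +oo)%E) ->
  'E_P[fun w => dfact lam (Y w) n]%E \is a fin_num.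
Proof.
move=> /nbhs_ballP[e /= e0 Me].
have mY : measurable_fun [set: T] Y by [].
have mgf_int (r : R) : `|r| < e ->
    P.-integrable [set: T] (EFin \o (fun w => expR (r * Y w))).
  move=> re; apply/integrableP; split.
    apply/measurable_EFinP; apply: measurableT_comp => //.
    exact: measurable_funM.
  have := Me r; rewrite /ball/= sub0r normrN => /(_ re).
  rewrite /mmt_gen_fun unlock; apply: le_lt_trans; rewrite le_eqVlt.
  apply/orP; left; apply/eqP.
  apply: eq_integral => w _ /=.
  by rewrite ger0_norm ?expR_ge0// [Y w * r]mulrC.
(* Both [t] and [- t] lie in the ball of radius [e]. The rate [t / n.+1] gives a total exponent of
   at most [t], and is defined also for [n = 0]. *)
pose t := e / 2; have t0 : 0 < t by rewrite divr_gt0.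
have te : t < e by rewrite /t; lra.
have s0 : 0 < t / n.+1%:R by rewrite divr_gt0.
have [C C0 HC] := dfact_expR_bound lam n s0.
have sn : t / n.+1%:R *+ n <= t.
  by rewrite -mulr_natr mulrAC ler_pdivrMr// ler_pM2l// ler_nat.
rewrite unlock; apply: integrable_fin_num => //.
apply: (@le_integrable _ _ _ _ _ measurableT _
  (fun w => C%:E * ((EFin \o (fun w => expR (t * Y w))) \+
                    (EFin \o (fun w => expR (- t * Y w)))) w)%E).
- apply/measurable_EFinP; rewrite /dfact.
  by apply: measurable_prod => i _; apply: measurable_funB.
- move=> w _; rewrite /= lee_fin (le_trans (HC _))//.
  apply: le_trans (ler_norm _); apply: ler_wpM2l => //.
  apply: (@le_trans _ _ (expR (t * `|Y w|))).
    by rewrite ler_expR ler_wpM2r.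
  have [y0|y0] := ger0P (Y w).
    by rewrite lerDl expR_ge0.
  by rewrite mulrN mulNr lerDr expR_ge0.
- apply: integrableZl => //; apply: integrableD => //; apply: mgf_int.
    by rewrite gtr0_norm.
  by rewrite normrN gtr0_norm.
Qed.

Theorem theorem2p4 (d : measure_display) (T : measurableType d) (R : realType)
    (P : probability T R) (Y : {RV P >-> R}) (lam x : R) (k n : nat)
    (hmgf : \forall t \near (0 : R), ('M_P Y t < +oo)%E)
    (hx : 0 <= x <= 1) (hxk : dfact lam x k != 0) (hkn : (k <= n)%N) :
  'E_P[fun w => dfact lam (Y w) (n - k)%N]%E =
  (\sum_(0 <= l < (n - k).+1) \sum_(0 <= j < l.+1)
     gbinom x j / dbinom lam x k * (j`!%:R / k`!%:R) * pdstirling2 Y lam l j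
       * ('C(n, l)%:R / 'C(n, k)%:R) * pdbernstein Y lam k (n - l)%N x)%:E.
Proof.
rewrite -[LHS]fineK; last exact: expectation_dfact_fin_num.
congr (_%:E); rewrite -/(dmoment Y lam (n - k)).
have fact_neq0 i : i`!%:R != 0 :> R by rewrite pnatr_eq0 -lt0n fact_gt0.
have f0 := dmgf0 Y lam.
have -> : dmoment Y lam (n - k) = (n - k)`!%:R * dmgf Y lam (n - k)%N.
  by rewrite /dmgf mulrC divfK.
(* The moment series is its own first power, with exponent [1 = x + (1 - x)]. *)
rewrite -(fps_rpow1 (n - k)%N f0) -[X in fps_rpow _ X](subrKC x).
rewrite -(fps_rpow_mul x (1 - x) _ f0) /fps_mul big_mkord mulr_sumr.
apply: eq_bigr => l _; have lnk : (l <= n - k)%N by rewrite -ltnS.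
have ln : (l <= n)%N := leq_trans lnk (leq_subr _ _).
rewrite fps_rpowE// mulr_suml mulr_sumr big_mkord.
apply: eq_bigr => j _.
(* The factor [t^k] keeps only the index [k] of the Cauchy product, available as [k <= n - l], and
   shifts the degree to [n - k - l]. *)
have -> : pdbernstein Y lam k (n - l) x =
    (n - l)`!%:R * dbinom lam x k * fps_rpow (dmgf Y lam) (1 - x) (n - k - l)%N.
  rewrite /pdbernstein /egf_coef /fps_scale /dbinom [_^-1 * _]mulrC mulrA.
  congr (_ * _); have kl : (k < (n - l).+1)%N.
    by rewrite ltnS leq_subRL// addnC -leq_subRL.
  rewrite /fps_mul (bigD1 (Ordinal kl))//= /fps_monom eqxx mul1r subnAC.
  by rewrite big1 ?addr0// => i; rewrite -val_eqE/= => /negPf ->; rewrite mul0r.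
rewrite /pdstirling2 /egf_coef /fps_scale.
have b0 : dbinom lam x k != 0 by rewrite mulf_neq0// invr_eq0.
(* With binomials as factorial quotients, all normalising factors cancel. *)
have Cnk : 'C(n, k)%:R = n`!%:R / (k`!%:R * (n - k)`!%:R) :> R.
  by rewrite -(bin_fact hkn) !natrM mulfK// mulf_neq0.
have Cnl : 'C(n, l)%:R = n`!%:R / (l`!%:R * (n - l)`!%:R) :> R.
  by rewrite -(bin_fact ln) !natrM mulfK// mulf_neq0.
rewrite Cnk Cnl; field.
by rewrite !fact_neq0 b0.
Qed.
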